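(* Let $G$ be a torsion-free polycyclic group. Then $pd(G) \le h(G)$.
   Context: A group $G$ is polycyclic if it has a finite subnormal series $G = G_1 \unrhd G_2 \unrhd \cdots \unrhd G_k\unrhd G_{k+1}=1$ with cyclic quotients $G_i/G_{i+1}$. The number $h(G)$ of infinite cyclic quotients in such a series does not depend on the series and is called the Hirsch length of $G$. A group $H$ discriminates a group $K$ if for every finite subset $E\subseteq K$ there is a homomorphism $K \to H$ injective on $E$. The projective dimension $pd(H)$ of a group $H$ is the supremum of the lengths $k$ of chains of proper epimorphisms (epimorphisms with non-trivial kernel) of groups $$H = H_1\to H_2\to\cdots\to H_{k+1}$$ such that for each $i=1,\ldots,k+1$ the groups $H_i$ and $H$ discriminate each other (without coefficients). *)

(* Defs.v *)
From mathcomp Require Import all_boot all_order all_algebra.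
From mathcomp Require Import mathcomp_extra boolp classical_sets functions.
From mathcomp Require Import cardinality constructive_ereal.

Set Implicit Arguments.
Unset Strict Implicit.
Unset Printing Implicit Defensive.

Import Order.TTheory GRing.Theory Num.Theory.

Local Open Scope classical_set_scope.
Local Open Scope group_scope.

(* MathComp's [groupType] allows infinite groups.  A choice operator is part of
   the structure, which is no restriction classically.  Subsets of a group are
   Prop-valued ([set G]), and [UMagmaMorphism.type K H] is the type of group
   homomorphisms from K to H. *)

Definition torsion_free (G : groupType) : Prop :=
  forall (x : G) (n : nat), (0 < n)%N -> x ^+ n = 1 -> x = 1.

Section Subgroups.
Variable G : groupType.
Implicit Types N H : set G.

Definition subgroup H : Prop := group_closed [in H].

Definition normal_in N H : Prop :=
  N `<=` H /\ (forall x y : G, H x -> N y -> N (y ^ x)).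

Definition coset (N : set G) (x : G) : set G := [set x * y | y in N].

(* The underlying set of the quotient group H / N. *)
Definition quotient_set H N : set (set G) := [set coset N x | x in H].

(* The n-th power of the coset xN in H / N is the coset of x ^+ n. *)
Definition cyclic_quotient H N : Prop :=
  exists2 x : G, H x & forall C, quotient_set H N C ->
    exists n : nat, C = coset N (x ^+ n) \/ C = coset N (x ^- n).

(* [S i], for i = 0, ..., k, is the term G_(i+1) of the series; the other values
   of S are irrelevant. *)
Definition polycyclic_series (k : nat) (S : nat -> set G) : Prop :=
  [/\ S 0%N = [set: G],
      S k = [set 1],
      forall i, (i <= k)%N -> subgroup (S i) &
      forall i, (i < k)%N ->
        normal_in (S i.+1) (S i) /\ cyclic_quotient (S i) (S i.+1)].

Definition infinite_quotients (k : nat) (S : nat -> set G) : nat :=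
  #|[set i : 'I_k | `[< infinite_set (quotient_set (S i) (S i.+1)) >]]%SET|.

End Subgroups.

Definition polycyclic (G : groupType) : Prop :=
  exists k (S : nat -> set G), polycyclic_series k S.

(* The value on some polycyclic series of G (all of them give the same one);
   junk value 0 if G is not polycyclic. *)
Definition hirsch_length (G : groupType) : nat :=
  xget 0%N [set h | exists k (S : nat -> set G),
    polycyclic_series k S /\ infinite_quotients k S = h].

Definition discriminates (H K : groupType) : Prop :=
  forall E : set K, finite_set E ->
    exists f : UMagmaMorphism.type K H, {in E &, injective f}.

Definition kernel (H K : groupType) (f : UMagmaMorphism.type H K) : set H :=
  [set x | f x = 1].

Definition proper_epi (H K : groupType) (f : UMagmaMorphism.type H K) : Prop :=
  range f = [set: K] /\ kernel f <> [set 1].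

(* [Hs i] is the term H_(i+1) of the chain, for i = 0, ..., k. *)
Definition proper_epi_chain (H : groupType) (k : nat) (Hs : nat -> groupType)
    : Prop :=
  [/\ Hs 0%N = H,
      forall i, (i <= k)%N -> discriminates (Hs i) H /\ discriminates H (Hs i) &
      forall i, (i < k)%N ->
        exists f : UMagmaMorphism.type (Hs i) (Hs i.+1), proper_epi f].

Definition chain_lengths (H : groupType) : set (\bar int) :=
  [set (k%:Z)%:E%E | k in [set k | exists Hs, proper_epi_chain H k Hs]].

(* The supremum is taken in {-oo} U Z U {+oo}, hence is +oo when the lengths
   are unbounded. *)
Definition pd (H : groupType) : \bar int := supremum -oo%E (chain_lengths H).

Lemma chain_lengths0 (H : groupType) : chain_lengths H 0%E.
Proof.
exists 0%N => //; exists (fun=> H); split=> // i _.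
by split=> E _; exists (idfun : UMagmaMorphism.type H H).
Qed.

(* In \bar int the default value of [supremum] is not used here: [pd H] is the
   least upper bound of the lengths. *)
Lemma pd_supremums (H : groupType) : supremums (chain_lengths H) (pd H).
Proof.
have neS : supremums (chain_lengths H) !=set0.
  have [[M ubM]|unb] :=
      pselect (exists M : nat, forall k Hs, proper_epi_chain H k Hs -> (k <= M)%N).
    have exB : exists n, `[< exists Hs, proper_epi_chain H n Hs >].
      by have [k [Hs Hk]] := chain_lengths0 H; exists k; apply/asboolP; exists Hs.
    have ubB n : `[< exists Hs, proper_epi_chain H n Hs >] -> (n <= M)%N.
      by move=> /asboolP[Hs /ubM].
    case: (ex_maxnP exB ubB) => m /asboolP mP maxm.
    exists (m%:Z)%:E%E; split.
      move=> _ [k kP <-]; rewrite lee_fin lez_nat.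
      by apply: maxm; apply/asboolP.
    by move=> z; apply; exists m.
  exists +oo%E; split; first by move=> *; exact: leey.
  case=> [z| |] // ubz.
    case: unb; exists `|z|%N => k Hs HsP.
    have /ubz : chain_lengths H (k%:Z)%:E%E by exists k => //; exists Hs.
    by rewrite lee_fin -lez_nat => /le_trans; apply; rewrite abszE ler_norm.
  by have := ubz _ (chain_lengths0 H).
rewrite /pd /supremum; case: ifPn => [/eqP S0|_].
  by have := chain_lengths0 H; rewrite S0.
by case: neS => x xS; case: xgetP => [y _ //|/(_ x)].
Qed.

(* Main.v *)
Require Import Defs.
From mathcomp Require Import all_boot all_order all_algebra.
From mathcomp Require Import mathcomp_extra boolp classical_sets functions.
From mathcomp Require Import cardinality constructive_ereal.

Local Open Scope classical_set_scope.
Local Open Scope group_scope.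

(** Each term of the chain is discriminated by G, hence torsion-free, so every
    kernel N in the chain is torsion-free and non-trivial.  Push a polycyclic
    series S of the source forward along the epimorphism.  An infinite image
    factor comes from an infinite factor.  If i is the last index such that N
    meets S i non-trivially, then S i / S i.+1 is infinite, as powers of an
    element of N in S i are distinct modulo S i.+1, while its cyclic image is
    finite, as a non-zero power of the generator dies.  So every step of
    the chain lowers the number of infinite factors. *)

Lemma subgroupP {G : groupType} (H : set G) :
  subgroup H <-> H 1 /\ forall x y, H x -> H y -> H (x / y).
Proof.
split=> [[/set_mem H1 Hd]|[H1 Hd]].
  split=> // x y Hx Hy; apply/set_mem; apply: (Hd x y); exact/mem_set.
split; first exact/mem_set.
by move=> x y /set_mem Hx /set_mem Hy; apply/mem_set/Hd.
Qed.

Section SubgroupTheory.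
Variables (G : groupType) (H : set G).
Hypothesis sgH : subgroup H.

Lemma subgroup1 : H 1.
Proof. by have /subgroupP[] := sgH. Qed.

Lemma subgroupV x : H x -> H x^-1.
Proof.
by move=> Hx; have /subgroupP[H1 Hd] := sgH; rewrite -[x^-1]mul1g; apply: Hd.
Qed.

Lemma subgroupM x y : H x -> H y -> H (x * y).
Proof.
move=> Hx /subgroupV Hy; have /subgroupP[_ Hd] := sgH.
by rewrite -[y]invgK; apply: Hd.
Qed.

Lemma subgroupX x n : H x -> H (x ^+ n).
Proof.
move=> Hx; elim: n => [|n IH]; first exact: subgroup1.
by rewrite expgS; apply: subgroupM.
Qed.

Lemma coset_eqP x y : coset H x = coset H y <-> H (x^-1 * y).
Proof.
split=> [exy|Hxy].
  have: coset H y y by exists 1; [exact: subgroup1 | rewrite mulg1].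
  by rewrite -exy => -[z Hz <-]; rewrite mulKg.
apply/seteqP; split=> _ [z Hz <-].
  exists ((x^-1 * y)^-1 * z); first exact: subgroupM (subgroupV _ Hxy) Hz.
  by rewrite invgM invgK !mulgA mulgV mul1g.
exists ((x^-1 * y) * z); first exact: subgroupM.
by rewrite !mulgA mulgV mul1g.
Qed.

End SubgroupTheory.

(** If [x ^+ m] and [x ^+ n] with [m < n] had the same coset, [x ^+ (n - m)] would lie in [N]; so
    the powers of [x] embed [nat] into the quotient. *)
Lemma infinite_quotient_set {G : groupType} (H N : set G) (x : G) :
  subgroup H -> subgroup N -> H x ->
  (forall n, (0 < n)%N -> ~ N (x ^+ n)) -> infinite_set (quotient_set H N).
Proof.
move=> sgH sgN Hx Nx finQ; apply: infinite_nat.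
have -> : [set: nat] = (fun n => coset N (x ^+ n)) @^-1` quotient_set H N.
  apply/seteqP; split=> n // _; exists (x ^+ n) => //; exact: subgroupX.
apply: finite_preimage finQ => m n _ _.
wlog lemn : m n / (m <= n)%N.
  by move=> h; case: (leqP m n) => [|/ltnW] le /= e; [|apply/esym]; apply: h.
move=> /= /(coset_eqP _ _ sgN).
rewrite -(subnKC lemn) expgnDr mulKg => Nmn.
case: (posnP (n - m)) => [->|/Nx//]; by rewrite addn0.
Qed.

(** Modulo [N], exponents of [c] matter only modulo [m], so the residues below [m] already give
    every coset. *)
Lemma finite_cyclic_quotient {G : groupType} (H N : set G) (c : G) (m : nat) :
  subgroup N -> (0 < m)%N -> N (c ^+ m) ->
  (forall C, quotient_set H N C ->
     exists n : nat, C = coset N (c ^+ n) \/ C = coset N (c ^- n)) ->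
  finite_set (quotient_set H N).
Proof.
move=> sgN m0 Ncm gen.
apply: sub_finite_set (finite_image (fun n => coset N (c ^+ n)) (finite_II m)).
have pos n : exists2 k, (k < m)%N & coset N (c ^+ k) = coset N (c ^+ n).
  exists (n %% m)%N; first by rewrite ltn_mod.
  apply/(coset_eqP _ _ sgN); rewrite {2}(divn_eq n m) addnC expgnDr mulKg.
  by rewrite mulnC expgnA; apply: subgroupX.
move=> C /gen[n [->|->]].
  by have [k ltkm <-] := pos n; exists k.
(* The exponents [n * m.-1] and [-n] differ by [n * m], so they give the same coset. *)
have [k ltkm ek] := pos (n * m.-1)%N; exists k => //; rewrite ek.
apply/esym/(coset_eqP _ _ sgN).
by rewrite invgK -expgnDr -mulnS prednK // mulnC expgnA; apply: subgroupX.
Qed.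

Section Image.
Variables (G K : groupType) (f : UMagmaMorphism.type G K).

Lemma subgroup_image (H : set G) : subgroup H -> subgroup (f @` H).
Proof.
move=> /subgroupP[H1 Hd]; apply/subgroupP; split.
  by exists 1 => //; rewrite gmulf1.
by move=> _ _ [x Hx <-] [y Hy <-]; exists (x / y); [apply: Hd | rewrite gmulfF].
Qed.

Lemma normal_in_image (N H : set G) :
  normal_in N H -> normal_in (f @` N) (f @` H).
Proof.
move=> [NH nN]; split; first exact: image_subset.
move=> _ _ [x Hx <-] [y Ny <-]; exists (y ^ x); first exact: nN.
by rewrite gmulfJ.
Qed.

Lemma image_coset (N : set G) x : f @` coset N x = coset (f @` N) (f x).
Proof.
apply/seteqP; split.
  by move=> _ [_ [y Ny <-] <-]; exists (f y); [exists y | rewrite gmulfM].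
move=> _ [_ [y Ny <-] <-]; exists (x * y); first by exists y.
by rewrite gmulfM.
Qed.

Lemma image_quotient_set (N H : set G) :
  quotient_set (f @` H) (f @` N) = [set f @` C | C in quotient_set H N].
Proof.
apply/seteqP; split.
  move=> _ [_ [x Hx <-] <-]; exists (coset N x); first by exists x.
  exact: image_coset.
move=> _ [_ [x Hx <-] <-]; exists (f x); first by exists x.
by rewrite image_coset.
Qed.

(** Kept apart from [cyclic_quotient_image] because the finiteness argument below needs the
    generator of the image to be [f c] itself. *)
Lemma cyclic_generator_image (N H : set G) (c : G) :
  (forall C, quotient_set H N C ->
     exists n : nat, C = coset N (c ^+ n) \/ C = coset N (c ^- n)) ->
  forall C, quotient_set (f @` H) (f @` N) C ->
    exists n : nat,
      C = coset (f @` N) (f c ^+ n) \/ C = coset (f @` N) (f c ^- n).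
Proof.
move=> gen C; rewrite image_quotient_set => -[D /gen[n eD] <-]; exists n.
by case: eD => ->; [left|right]; rewrite image_coset ?gmulfV gmulfXn.
Qed.

Lemma cyclic_quotient_image (N H : set G) :
  cyclic_quotient H N -> cyclic_quotient (f @` H) (f @` N).
Proof.
move=> [c Hc gen]; exists (f c); first by exists c.
exact: cyclic_generator_image.
Qed.

Lemma polycyclic_series_image k (S : nat -> set G) :
  range f = [set: K] -> polycyclic_series k S ->
  polycyclic_series k (fun i => f @` S i).
Proof.
move=> surj [S0 Sk sgS Sq]; split.
- by rewrite S0.
- by rewrite Sk image_set1 gmulf1.
- by move=> i /sgS; apply: subgroup_image.
- move=> i /Sq[nS cS]; split; first exact: normal_in_image.
  exact: cyclic_quotient_image.
Qed.

Lemma infinite_quotients_image k (S : nat -> set G) :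
  torsion_free G -> polycyclic_series k S -> kernel f <> [set 1] ->
  (infinite_quotients k (fun i => f @` S i) < infinite_quotients k S)%N.
Proof.
move=> tf [S0 Sk sgS Sq] kerN1.
have [x0 [x0N1 fx0]] : exists x, x <> 1 /\ f x = 1.
  apply: contrapT => no; apply: kerN1; apply/seteqP; split=> x /=.
    by move=> fx; apply: contrapT => xN1; apply: no; exists x.
  by move=> ->; rewrite /kernel /= gmulf1.
(* The bound by [k] makes a last index exist; it is below [k] since [S k] is trivial. *)
pose P i := `[< (i <= k)%N /\ exists x, [/\ S i x, x <> 1 & f x = 1] >].
have exP : exists i, P i.
  by exists 0%N; apply/asboolP; split=> //; exists x0; rewrite S0.
have leP i : P i -> (i <= k)%N by move=> /asboolP[].
have [i /asboolP[leik [x [Six xN1 fx1]]] maxi] := ex_maxnP exP leP.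
have ltik : (i < k)%N.
  by rewrite ltn_neqAle leik andbT; apply/eqP=> eik; move: Six; rewrite eik Sk.
have [sgi sgi1] := (sgS _ leik, sgS _ ltik).
(* By torsion-freeness [x ^+ n] is again a non-trivial kernel element, so finding it in [S i.+1]
   would contradict the maximality of [i]. *)
have xS n : (0 < n)%N -> ~ S i.+1 (x ^+ n).
  move=> n0 Sxn; suff /maxi : P i.+1 by rewrite ltnn.
  apply/asboolP; split=> //; exists (x ^+ n); split=> //.
    by move=> /(tf _ _ n0).
  by rewrite gmulfXn fx1 expg1n.
have infi := infinite_quotient_set _ _ _ sgi sgi1 Six xS.
have [_ [c Sc gen]] := Sq _ ltik.
(* Modulo [S i.+1], [x] is [c ^+ m] or [c ^- m], and [f] kills [x]. Here [m] is not 0, since [x]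
   itself lies outside [S i.+1]. *)
have [m m0 fcm] : exists2 m, (0 < m)%N & (f @` S i.+1) (f c ^+ m).
  have [|m eC] := gen (coset (S i.+1) x); first by exists x.
  exists m.
    rewrite lt0n; apply/eqP=> m0; apply: (xS 1%N) => //.
    have: coset (S i.+1) 1 = coset (S i.+1) x by case: eC; rewrite m0 ?invg1.
    by move=> /(coset_eqP _ _ sgi1); rewrite invg1 mul1g.
  case: eC => /esym/(coset_eqP _ _ sgi1) S1.
    exists ((c ^- m * x)^-1); first exact: subgroupV.
    by rewrite gmulfV gmulfM fx1 mulg1 gmulfV invgK gmulfXn.
  exists ((c ^- m)^-1 * x) => //.
  by rewrite gmulfM fx1 mulg1 invgK gmulfXn.
have fini : finite_set (quotient_set (f @` S i) (f @` S i.+1)).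
  apply: finite_cyclic_quotient m0 fcm (cyclic_generator_image _ _ _ gen).
  exact: subgroup_image.
(* Infinite image factors sit at indices of infinite factors of [S], and [i] is an index that gets
   lost. *)
apply: proper_card; apply/properP; split.
  apply/fintype.subsetP => j; rewrite !finset.inE => /asboolP infj.
  apply/asboolP=> finj; apply: infj.
  by rewrite image_quotient_set; apply: finite_image.
by exists (Ordinal ltik); rewrite finset.inE; [apply/asboolP|apply/asboolPn].
Qed.

End Image.

(** A homomorphism to [G] separating [x] from [1] would carry a torsion element [x] to a non-trivial
    torsion element of [G]. *)
Lemma discriminates_torsion_free {G K : groupType} :
  discriminates G K -> torsion_free G -> torsion_free K.
Proof.
move=> disc tf x n n0 xn1.
have [f injf] := disc [set 1; x] (finite_set2 _ _).
apply: injf; [by apply/mem_set; right|by apply/mem_set; left|].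
by rewrite gmulf1; apply: tf n0 _; rewrite -gmulfXn xn1 gmulf1.
Qed.

Lemma proper_epi_chain_length {G : groupType} (n k : nat) (S : nat -> set G)
    (Hs : nat -> groupType) :
  torsion_free G -> polycyclic_series n S -> proper_epi_chain G k Hs ->
  (k <= infinite_quotients n S)%N.
Proof.
move=> tfG pS [Hs0 disc epi].
(* [T] is [S] pushed through the first [j] epimorphisms, each of which costs at least one infinite
   factor. *)
suff /(_ k (leqnn k))[T _] : forall j, (j <= k)%N ->
    exists2 T : nat -> set (Hs j), polycyclic_series n T &
      (infinite_quotients n T + j <= infinite_quotients n S)%N.
  exact/leq_trans/leq_addl.
elim=> [_|j IH ltjk]; first by rewrite Hs0; exists S; rewrite ?addn0.
have [T pT leT] := IH (ltnW ltjk).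
have tfj := discriminates_torsion_free (disc _ (ltnW ltjk)).2 tfG.
have [f [surj kerN1]] := epi _ ltjk.
exists (fun i => f @` T i); first exact: polycyclic_series_image.
apply: leq_trans leT; rewrite addnS -addSn leq_add2r.
exact: infinite_quotients_image.
Qed.

Theorem proposition3p6 (G : groupType)
    (tfG : torsion_free G) (pcG : polycyclic G) :
  (pd G <= ((hirsch_length G)%:Z)%:E)%E.
Proof.
(* Polycyclicity rules out the default value 0 of [xget], so the Hirsch length is attained by an
   actual series. *)
have [n [S [pS <-]]] : exists k (S : nat -> set G),
    polycyclic_series k S /\ infinite_quotients k S = hirsch_length G.
  have [k [S pS]] := pcG; rewrite /hirsch_length.
  case: xgetP => [h _ //|/(_ (infinite_quotients k S))[]]; by exists k, S.
have [_ lb] := pd_supremums G; apply: lb => _ [k [Hs chain] <-].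
rewrite lee_fin lez_nat.
exact: proper_epi_chain_length chain.
Qed.
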